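(* Let $p$ be an odd prime, let $r=\frac{p-1}{2}$, let $\ell$ be an odd integer with $\gcd(\ell,p-1)=1$, and let $\xi\in\mathbb{F}_p^\times$ be a fixed primitive $(p-1)$-th root of unity. Then the number of sign vectors $\epsilon=(\epsilon_0,\dots,\epsilon_{r-1})\in\{\pm1\}^r$ such that $$\sum_{n=0}^{r-1}\epsilon_n\xi^{n\ell}=0\quad\text{in }\mathbb{F}_p$$ is $$\frac1p\left(2^r+(p-1)\left(\frac 2p\right)\right),$$ where $\left(\frac 2p\right)$ is the Legendre symbol.
   Context: $\mathbb{F}_p$ is the field with $p$ elements; signs $\pm1$ are viewed as elements of $\mathbb{F}_p$. *)

(* Defs.v *)
From HB Require Import structures.
From mathcomp Require Import all_boot all_order all_algebra.

Set Implicit Arguments.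
Unset Strict Implicit.
Unset Printing Implicit Defensive.

Import Order.TTheory GRing.Theory Num.Theory.
Local Open Scope ring_scope.

(* 'F_p has p elements only when p is prime (it is built from the least prime
   factor of p); this is the Legendre symbol (a / p) when p is an odd prime. *)
Definition legendre (p : nat) (a : int) : int :=
  if (a%:~R : 'F_p) == 0 then 0
  else if [exists x : 'F_p, x ^+ 2 == a%:~R] then 1 else -1.

(* Since 1 != -1 in 'F_p for p odd, these vectors over 'F_p correspond one to
   one to the 2 ^ r sign vectors. *)
Definition sign_vectors (p r : nat) : {set {ffun 'I_r -> 'F_p}} :=
  [set eps : {ffun 'I_r -> 'F_p} | [forall n, (eps n == 1) || (eps n == -1)]].

(* Main.v *)
Require Import Defs.
From HB Require Import structures.
From mathcomp Require Import all_boot all_order all_algebra.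
From mathcomp Require Import all_field.

(** Put eta = xi ^ l, again a primitive root, so that eta ^ r = -1, and let psi
    be a nontrivial additive character of F_p.  By orthogonality, p times the
    number of solutions is the sum over t of
      \prod_(n < r) (psi (t eta^n) + psi (- t eta^n)).
    The term t = 0 is 2 ^ r.  For t != 0 put g a = psi a - psi (- a); since
    (psi a + psi (- a)) * g a = g (2 a), the term is the quotient of
    \prod_n g (2 t eta^n) by \prod_n g (t eta^n).  As g is odd, multiplying its
    argument by eta only changes the sign of the latter product, so with
    2 = eta ^ k the quotient is (-1) ^ k, which is the Legendre symbol. *)

Set Implicit Arguments.
Unset Strict Implicit.
Unset Printing Implicit Defensive.

Import Order.TTheory GRing.Theory Num.Theory.
Local Open Scope ring_scope.

Lemma prim_root_exprz (F : fieldType) (m : nat) (x : F) (l : int) :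
  m.-primitive_root x -> coprimez l m -> m.-primitive_root (x ^ l).
Proof.
move=> x_prim l_co; have m_gt0 := prim_order_gt0 x_prim.
have x_neq0 : x != 0 by rewrite (prim_root_eq0 x_prim) -lt0n.
have mod_ge0 : 0 <= (l %% m)%Z by rewrite modz_ge0 // eqz_nat -lt0n.
(* As [l] may be negative, it is traded for its residue modulo [m], a natural exponent. *)
have -> : x ^ l = x ^+ `|(l %% m)%Z|.
  rewrite {1}(divz_eq l m) expfzDr // [(_ %/ _)%Z * _]mulrC -exprz_exp -exprnP.
  by rewrite (prim_expr_order x_prim) exp1rz mul1r exprnP gez0_abs.
rewrite (prim_root_exp_coprime _ x_prim).
by move: l_co; rewrite /coprimez -gcdz_modl /gcdz /coprime.
Qed.

Lemma prim_root_half (F : fieldType) (r : nat) (x : F) :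
  (r.*2).-primitive_root x -> x ^+ r = -1.
Proof.
move=> x_prim; have := prim_order_gt0 x_prim; rewrite double_gt0 => r_gt0.
have : (x ^+ r) ^+ 2 == 1 by rewrite -exprM muln2 (prim_expr_order x_prim).
rewrite sqrf_eq1 => /orP[|/eqP//].
rewrite -(prim_order_dvd x_prim) => /(dvdn_leq r_gt0).
by rewrite -addnn -{3}[r]addn0 leq_add2l leqNgt r_gt0.
Qed.

Lemma Fp_prim_root_log (p : nat) (x a : 'F_p) :
  prime p -> (p - 1)%N.-primitive_root x -> a != 0 -> exists k, a = x ^+ k.
Proof.
move=> p_prime x_prim a_neq0.
have a1 : a ^+ (p - 1) = 1.
  apply: (mulfI a_neq0); rewrite mulr1 -exprS subn1 prednK ?prime_gt0 //.
  by have := expf_card a; rewrite card_Fp.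
by have [k ->] := prim_rootP x_prim a1; exists k.
Qed.

(** Squares are the even powers of [x]: since [p - 1] is even, the parity of an exponent survives
    reduction modulo [p - 1]. *)
Lemma legendre_prim_root (p : nat) (a : int) (x : 'F_p) (k : nat) :
  prime p -> odd p -> (p - 1)%N.-primitive_root x ->
  a%:~R = x ^+ k -> legendre p a = (-1) ^+ k.
Proof.
move=> p_prime p_odd x_prim ak; rewrite /legendre ak.
have x_neq0 : x != 0.
  by rewrite (prim_root_eq0 x_prim) -lt0n (prim_order_gt0 x_prim).
rewrite expf_eq0 (negPf x_neq0) andbF -signr_odd.
have p1_even : (2 %| p - 1)%N by rewrite dvdn2 oddB ?prime_gt0 ?p_odd.
case: existsP => [[y /eqP yk]|no_root].
  have y_neq0 : y != 0.
    by apply: contra_neq (expf_neq0 k x_neq0) => y0; rewrite -yk y0 expr0n.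
  have [j yj] := Fp_prim_root_log p_prime x_prim y_neq0.
  move/eqP: yk; rewrite yj -exprM (eq_prim_root_expr x_prim).
  move/eqP/(congr1 (modn^~ 2)); rewrite !modn_dvdm // modnMl modn2.
  by case: (odd k).
case: (boolP (odd k)) => [//|k_even]; case: no_root; exists (x ^+ k./2).
by rewrite -exprM muln2 even_halfK.
Qed.

(** The exponent is the representative of [a] as a natural number, so additivity comes only with [p]
    prime and [z ^+ p = 1]. *)
Definition addchar (p : nat) (R : pzRingType) (z : R) (a : 'F_p) : R := z ^+ a.

Lemma addchar0 (p : nat) (R : pzRingType) (z : R) : addchar z (0 : 'F_p) = 1.
Proof. by []. Qed.

Lemma addcharD (p : nat) (R : pzRingType) (z : R) (a b : 'F_p) :
  prime p -> z ^+ p = 1 -> addchar z (a + b) = addchar z a * addchar z b.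
Proof.
move=> p_prime zp; rewrite /addchar -exprD -[RHS](expr_mod _ zp) /=.
by congr (_ ^+ (_ %% _)); apply: Fp_cast.
Qed.

Lemma addchar_sum (p : nat) (R : pzRingType) (z : R) (I : finType)
    (F : I -> 'F_p) : prime p -> z ^+ p = 1 ->
  addchar z (\sum_i F i) = \prod_i addchar z (F i).
Proof.
by move=> p_prime zp; apply: (big_morph _ (fun a b => addcharD a b p_prime zp)).
Qed.

Lemma addchar_inj (p : nat) (R : nzRingType) (z : R) :
  prime p -> p.-primitive_root z -> injective (@addchar p R z).
Proof.
move=> p_prime z_prim a b /eqP; rewrite /addchar (eq_prim_root_expr z_prim).
have lt_p (c : 'F_p) : (c < p)%N by rewrite -[ltnRHS]Fp_cast.
by rewrite !modn_small // => /eqP/val_inj.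
Qed.

Lemma addchar_orthogonality (p : nat) (R : idomainType) (z : R) (s : 'F_p) :
  prime p -> p.-primitive_root z ->
  \sum_t addchar z (t * s) = p%:R * (s == 0)%:R.
Proof.
move=> p_prime z_prim; have zp := prim_expr_order z_prim.
have [->|s_neq0] := eqVneq s 0.
  under eq_bigr do rewrite mulr0 addchar0.
  by rewrite sumr_const card_Fp // mulr1.
rewrite mulr0; apply/eqP; set S := \sum_t _.
(* Translating [t] by 1 permutes the terms of [S] and multiplies each by [addchar z s], which
   differs from 1 by injectivity. *)
have : (addchar z s - 1) * S == 0.
  rewrite mulrBl mul1r subr_eq0 mulr_sumr /S.
  rewrite [eqbRHS](reindex_inj (addIr (1 : 'F_p))) /=; apply/eqP/eq_bigr => t _.
  by rewrite -addcharD // mulrDl mul1r addrC.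
rewrite mulf_eq0 subr_eq0 => /orP[/eqP s1|//].
by case/eqP: s_neq0; apply: (addchar_inj p_prime z_prim).
Qed.

(* Negacyclic shift: the factor leaving at one end returns at the other end
   with its sign changed. *)
Lemma prod_odd_shift (F : pzRingType) (R : comPzRingType) (g : F -> R)
    (r : nat) (x a : F) (k : nat) :
  (0 < r)%N -> (forall b, g (- b) = - g b) -> x ^+ r = -1 ->
  \prod_(n < r) g (a * x ^+ k * x ^+ n) =
    (-1) ^+ k * \prod_(n < r) g (a * x ^+ n).
Proof.
case: r => // r _ gN xr; elim: k => [|k IHk].
  by rewrite mul1r; under eq_bigr do rewrite mulr1.
rewrite [_ ^+ k.+1 in RHS]exprS -mulrA -IHk big_ord_recr [in RHS]big_ord_recl /= expr0 mulr1.
(* After the case split the length is [r.+1], so the last factor has exponent [k + r.+1], and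
   [x ^+ r.+1 = -1]. *)
have -> : a * x ^+ k.+1 * x ^+ r = - (a * x ^+ k).
  by rewrite -mulrA -exprD addSnnS exprD xr mulrN1 mulrN.
rewrite gN mulrN mulN1r mulrC; congr (- (_ * _)); apply: eq_bigr => n _.
by rewrite -!mulrA -!exprD addSnnS.
Qed.

Theorem theorem1p3 (p : nat) (p_prime : prime p) (p_odd : odd p)
    (r : nat) (r_def : r = ((p - 1) %/ 2)%N)
    (l : int) (l_odd : ~~ (2 %| l)%Z) (l_coprime : gcdz l (p%:Z - 1) = 1)
    (xi : 'F_p) (xi_unit : xi \is a GRing.unit)
    (xi_prim : (p - 1)%N.-primitive_root xi) :
  (#|[set eps in sign_vectors p r |
        (\sum_(n < r) eps n * xi ^ (n%:Z * l)) == 0]|%:R : rat)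
  = p%:R^-1 * (2 ^+ r + (p%:R - 1) * (legendre p 2)%:~R).
Proof.
have p_gt0 := prime_gt0 p_prime.
have r2 : (p - 1 = r.*2)%N.
  by rewrite r_def divn2 even_halfK // oddB ?p_odd.
have r_gt0 : (0 < r)%N by rewrite -double_gt0 -r2 subn_gt0 prime_gt1.
pose eta := xi ^ l.
have eta_prim : (p - 1)%N.-primitive_root eta.
  by apply: prim_root_exprz => //; rewrite /coprimez -subzn // l_coprime.
have eta_r : eta ^+ r = -1 by apply: prim_root_half; rewrite -r2.
have two_neq0 : 2%:~R != 0 :> 'F_p.
  rewrite -(dvdn_pcharf (pchar_Fp p_prime)) dvdn_prime2 //.
  by apply: contraL p_odd => /eqP ->.
(* The logarithm is taken to base [eta], not [xi], so that the same [k] gives both the Legendre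
   symbol and the length of the shift in the product. *)
have [k two_k] := Fp_prim_root_log p_prime eta_prim two_neq0.
rewrite (legendre_prim_root p_prime p_odd eta_prim two_k).
set N := #|_|.
have [z z_prim] := C_prim_root_exists p_gt0.
have zp := prim_expr_order z_prim.
pose psi : 'F_p -> algC := addchar z.
pose T t := \prod_(n < r) (psi (t * eta ^+ n) + psi (- (t * eta ^+ n))).
have pN : p%:R * N%:R = \sum_t T t.
  pose S (eps : {ffun 'I_r -> 'F_p}) := \sum_(n < r) eps n * eta ^+ n.
  transitivity (\sum_(eps in sign_vectors p r) \sum_t psi (t * S eps)).
    under eq_bigr do rewrite addchar_orthogonality //.
    rewrite -mulr_sumr -natr_sum /N -sum1_card; congr (_ * _%:R).
    transitivity (\sum_(eps in sign_vectors p r | S eps == 0%R) 1)%N.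
      apply: eq_bigl => eps; rewrite inE /S.
      by under eq_bigr do rewrite mulrC [_ * l]mulrC -exprz_exp -exprnP mulrC.
    by rewrite big_mkcondr; apply: eq_bigr => eps _; case: eqP.
  rewrite exchange_big; apply: eq_bigr => t _.
  (* Each factor is written as a sum over the two signs, so that expanding the product yields a sum
     over sign vectors. The signs are distinct by [two_neq0]. *)
  have sgn2 (n : 'I_r) : psi (t * eta ^+ n) + psi (- (t * eta ^+ n)) =
      \sum_(e | (e == 1) || (e == -1)) psi (t * (e * eta ^+ n)).
    rewrite (bigD1 1) ?eqxx //= (big_pred1 (-1)) => [|e].
      by rewrite !mul1r mulN1r mulrN.
    rewrite /=; have [->|_] := eqVneq e (-1); last by case: eqP.
    by rewrite orbT /= eq_sym -addr_eq0.
  rewrite /T (eq_bigr _ (fun n _ => sgn2 n)) bigA_distr_big.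
  apply: eq_big => [eps|eps _]; first by rewrite inE.
  by rewrite mulr_sumr -addchar_sum.
have T0 : T 0 = 2 ^+ r.
  rewrite /T /psi; under eq_bigr do rewrite mul0r oppr0 addchar0.
  by rewrite prodr_const card_ord.
have Tt t : t != 0 -> T t = (-1) ^+ k.
  move=> t_neq0; pose g a := psi a - psi (- a).
  have gN a : g (- a) = - g a by rewrite /g opprK opprB.
  (* If [g a] vanished, injectivity of [psi] would give [a = - a], hence [2 * a = 0]. *)
  have g_neq0 a : a != 0 -> g a != 0.
    move=> a_neq0; rewrite subr_eq0; apply: contra_neq a_neq0.
    move/(addchar_inj p_prime z_prim)/eqP; rewrite -subr_eq0 opprK -mulr2n.
    by rewrite -mulr_natl mulf_eq0 (negPf two_neq0) => /eqP.
  have eta_neq0 : eta != 0.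
    by rewrite (prim_root_eq0 eta_prim) -lt0n (prim_order_gt0 eta_prim).
  have g2 a : (psi a + psi (- a)) * g a = g (a * eta ^+ k).
    rewrite -two_k mulrC -subr_sqr /g !expr2 /psi -!addcharD //.
    by rewrite mulrzr -opprD.
  have P_neq0 : \prod_(n < r) g (t * eta ^+ n) != 0.
    by apply/prodf_neq0 => n _; rewrite g_neq0 // mulf_neq0 ?expf_neq0.
  apply: (mulIf P_neq0); rewrite -(prod_odd_shift t k r_gt0 gN eta_r) -big_split.
  by apply: eq_bigr => n _; rewrite /= g2 mulrAC.
(* The character sums live in [algC], but both sides are images of integers, so the identity
   descends to [int] and can then be mapped to [rat]. *)
have pN_int : p%:R * N%:R = 2 ^+ r + (p%:R - 1) * (-1) ^+ k :> int.
  apply: (@intr_inj algC); rewrite rmorphM /= rmorphD rmorphM rmorphB /=.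
  rewrite !rmorphXn /= rmorphN1 !rmorph_nat rmorph1 pN (bigD1 0) //= T0.
  rewrite (eq_bigr _ Tt) sumr_const cardC1 card_Fp // -subn1.
  by rewrite -[_ ^+ k *+ _]mulr_natl natrB.
have p_neq0 : p%:R != 0 :> rat by rewrite pnatr_eq0 -lt0n.
apply: (mulfI p_neq0); rewrite mulVKf //.
move/(congr1 (fun i : int => i%:~R : rat)): pN_int.
by rewrite rmorphM /= rmorphD rmorphM rmorphB /= !rmorphXn /= !rmorph_nat rmorph1.
Qed.
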